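(* Let $A>0$ and $B\neq 0$ be integers with $\Delta=A^2-4B>0$, and let $u_n=u_n(A,B)$ ($n\in\{0,1,2,\ldots\}$) be the Lucas sequence defined by $u_0=0$, $u_1=1$ and $u_{n+1}=Au_n-Bu_{n-1}$ for $n\geq 1$. Then there exists an integer $N>0$ such that the sequence $\left(\sqrt[n+1]{u_{n+1}}/\sqrt[n]{u_n}\right)_{n\geq N}$ is strictly decreasing and converges to $1$. In the case $A=1$ and $B=-1$ (so that $u_n=F_n$ is the Fibonacci sequence), one may take $N=4$, i.e. $\left(\sqrt[n+1]{F_{n+1}}/\sqrt[n]{F_n}\right)_{n\geq 4}$ is strictly decreasing with limit $1$.
   Context: Under these hypotheses $u_n>0$ for all $n\geq 1$, so the $n$-th roots are positive real numbers. The Fibonacci sequence is $F_0=0$, $F_1=1$, $F_{n+1}=F_n+F_{n-1}$. *)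

(* Defs.v *)
From Stdlib Require Import Reals ZArith Lra Lia.
From Coquelicot Require Import Coquelicot.

Fixpoint lucas (A B : Z) (n : nat) : Z :=
  match n with
  | O => 0
  | S O => 1
  | S (S k as m) => A * lucas A B m - B * lucas A B k
  end%Z.

Fixpoint fib (n : nat) : Z :=
  match n with
  | O => 0
  | S O => 1
  | S (S k as m) => fib m + fib k
  end%Z.

(** [Rpower x y] is [exp (y * ln x)], so this is the positive real n-th root
    only for [0 < x] and [n <> 0] (see [nth_root_spec]); [lucas_pos] below
    shows that the Lucas sequences considered here satisfy this for n >= 1. *)
Definition nth_root (n : nat) (x : R) : R := Rpower x (/ INR n).

Definition root_ratio (u : nat -> Z) (n : nat) : R :=
  (nth_root (S n) (IZR (u (S n))) / nth_root n (IZR (u n)))%R.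

Definition strictly_decreasing_from (N : nat) (a : nat -> R) : Prop :=
  forall n : nat, (N <= n)%nat -> (a (S n) < a n)%R.

Lemma nth_root_spec (n : nat) (x : R) (hn : n <> O) (hx : (0 < x)%R) :
  (0 < nth_root n x)%R /\ (nth_root n x ^ n = x)%R.
Proof.
  assert (hp : (0 < nth_root n x)%R) by apply exp_pos.
  split; [exact hp|].
  rewrite <- Rpower_pow by exact hp.
  unfold nth_root. rewrite Rpower_mult, Rinv_l by (now apply not_0_INR).
  now apply Rpower_1.
Qed.

Lemma lucas_pos (A B : Z) (hA : (0 < A)%Z) (hD : (0 < A ^ 2 - 4 * B)%Z)
    (n : nat) (hn : (1 <= n)%nat) : (0 < lucas A B n)%Z.
Proof.
  assert (H : forall k, (0 < lucas A B (S k) /\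
                         A * lucas A B (S k) < 2 * lucas A B (S (S k)))%Z).
  { induction k as [|k [IH1 IH2]]; [cbn [lucas]; lia|].
    assert (E : lucas A B (S (S (S k))) =
                (A * lucas A B (S (S k)) - B * lucas A B (S k))%Z) by reflexivity.
    rewrite E; clear E.
    set (x := lucas A B (S k)) in *. set (y := lucas A B (S (S k))) in *.
    assert (h1 := Z.mul_pos_pos _ _ hD IH1).
    assert (h2 : (0 < A * (2 * y - A * x))%Z) by (apply Z.mul_pos_pos; lia).
    split; nia. }
  destruct n as [|n]; [lia | apply H].
Qed.

(* Main.v *)
Require Import Defs.
From Stdlib Require Import Reals ZArith.
From Coquelicot Require Import Coquelicot.
From Stdlib Require Import Lra Lia.

(** Write [alpha > |beta|] for the roots of [X^2 - A X + B], [D = alpha - beta]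
    and [q = beta / alpha].  By Binet's formula,
    [ln u_n / n = ln alpha + (ln (1 - q^n) - ln D) / n], so the limit is clear,
    and monotonicity is strict concavity of [ln u_n / n].  The second difference
    of [- ln D / n] is of order [- ln D / n^3], which beats the exponentially
    small contribution of [q^n] as soon as [D > 1].  Since [D^2] is a positive
    integer, the remaining case is [D = 1]; then [B > 0], hence [q > 0], and
    [- ln (1 - q^n) / n] is strictly convex because both factors are positive,
    decreasing and convex. *)

Local Open Scope R_scope.

(** * Logarithm bounds and a vanishing sequence *)

Lemma ln_le_sub_1 (x : R) : 0 < x -> ln x <= x - 1.
Proof.
  intros hx. pose proof (exp_ineq1_le (ln x)) as h.
  rewrite exp_ln in h by exact hx. lra.
Qed.

(** The inequality [ln x <= x - 1] is applied both to [1 - t] and to its inverse; the latter gives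
    [t / (1 - t)], whose denominator is at least [1 - r]. *)
Lemma Rabs_ln_1_minus_le (t r : R) :
  Rabs t <= r -> r < 1 -> Rabs (ln (1 - t)) <= Rabs t / (1 - r).
Proof.
  intros h hr.
  pose proof (Rabs_pos t) as hp. pose proof (Rle_abs t) as h1.
  assert (h2 : - Rabs t <= t).
  { pose proof (Rle_abs (- t)) as h3. rewrite Rabs_Ropp in h3. lra. }
  assert (hs : Rabs t <= Rabs t / (1 - r)).
  { apply Rmult_le_reg_r with (1 - r); [lra|].
    unfold Rdiv. rewrite Rmult_assoc, Rinv_l by lra. nra. }
  assert (hi : 0 < / (1 - t)) by (apply Rinv_0_lt_compat; lra).
  pose proof (ln_le_sub_1 (1 - t) ltac:(lra)) as hu.
  pose proof (ln_le_sub_1 (/ (1 - t)) hi) as hl.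
  rewrite ln_Rinv in hl by lra.
  assert (he : / (1 - t) - 1 <= Rabs t / (1 - r)).
  { replace (/ (1 - t) - 1) with (t / (1 - t)) by (field; lra).
    apply Rmult_le_reg_r with ((1 - t) * (1 - r)); [nra|].
    replace (t / (1 - t) * ((1 - t) * (1 - r))) with (t * (1 - r)) by (field; lra).
    replace (Rabs t / (1 - r) * ((1 - t) * (1 - r))) with (Rabs t * (1 - t))
      by (field; lra).
    nra. }
  apply Rabs_le. lra.
Qed.

(** These are the terms of a convergent series, by the ratio test: the quotients
    [(1 + / (n + 1)) ^ 2 * r] tend to [r < 1]. The shift to [S n] keeps every term nonzero, as that
    test demands. *)
Lemma lim_sqr_mult_pow (r : R) :
  0 < r < 1 -> is_lim_seq (fun n => INR (S n) ^ 2 * r ^ n) 0.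
Proof.
  intros hr. apply ex_series_lim_0, ex_series_Rabs.
  apply ex_series_DAlembert with (k := r); [lra| |].
  - intros n. apply Rgt_not_eq, Rmult_lt_0_compat; apply pow_lt; [|lra].
    apply lt_0_INR; lia.
  - apply is_lim_seq_ext with (fun n => (1 + / INR (S n)) * (1 + / INR (S n)) * r).
    + intros n. assert (hn : 0 < INR (S n)) by (apply lt_0_INR; lia).
      assert (hp : 0 < r ^ n) by (apply pow_lt; lra).
      rewrite (S_INR (S n)), <- (tech_pow_Rmult r n).
      set (x := INR (S n)) in *. set (p := r ^ n) in *. clearbody x p.
      replace ((x + 1) ^ 2 * (r * p) / (x ^ 2 * p))
        with ((1 + / x) * (1 + / x) * r) by (field; lra).
      assert (hi : 0 < / x) by now apply Rinv_0_lt_compat.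
      symmetry. apply Rabs_pos_eq. nra.
    + assert (h : is_lim_seq (fun n => 1 + / INR (S n)) 1).
      { replace (Finite 1) with (Finite (1 + 0)) by (f_equal; ring).
        apply is_lim_seq_plus'; [apply is_lim_seq_const|].
        apply (is_lim_seq_incr_1 (fun n => / INR n)).
        replace (Finite 0) with (Rbar_inv p_infty) by reflexivity.
        apply is_lim_seq_inv; [apply is_lim_seq_INR | discriminate]. }
      replace (Finite r) with (Finite (1 * 1 * r)) by (f_equal; ring).
      apply is_lim_seq_mult'; [now apply is_lim_seq_mult'|apply is_lim_seq_const].
Qed.

(** * From root ratios to second differences of logarithms *)

Lemma root_ratio_exp (u : nat -> Z) (n : nat) :
  root_ratio u n = exp (ln (IZR (u (S n))) / INR (S n) - ln (IZR (u n)) / INR n).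
Proof.
  unfold root_ratio, nth_root, Rpower, Rdiv.
  rewrite <- exp_Ropp, <- exp_plus. f_equal. ring.
Qed.

(** [n (n + 1) (n + 2)] times the second difference of [l n / n]. *)
Definition second_diff (l : nat -> R) (n : nat) : R :=
  (INR n + 1) * (INR n + 2) * l n - 2 * INR n * (INR n + 2) * l (S n)
  + INR n * (INR n + 1) * l (S (S n)).

Lemma root_ratio_lt (u : nat -> Z) (n : nat) :
  (1 <= n)%nat -> second_diff (fun k => ln (IZR (u k))) n < 0 ->
  root_ratio u (S n) < root_ratio u n.
Proof.
  intros hn h. rewrite !root_ratio_exp. apply exp_increasing.
  unfold second_diff in h. rewrite !S_INR.
  assert (hp : 0 < INR n) by (apply lt_0_INR; lia).
  set (x := INR n) in *. revert h.
  generalize (ln (IZR (u n))) (ln (IZR (u (S n)))) (ln (IZR (u (S (S n))))).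
  intros a b c h.
  assert (hd : 0 < x * (x + 1) * (x + 2)) by (repeat apply Rmult_lt_0_compat; lra).
  apply Rmult_lt_reg_r with (x * (x + 1) * (x + 2)); [exact hd|].
  apply Rminus_lt.
  replace (_ - _) with
    ((x + 1) * (x + 2) * a - 2 * x * (x + 2) * b + x * (x + 1) * c)
    by (field; lra).
  exact h.
Qed.

(** * Characteristic roots and Binet's formula *)

Section Binet.

Variables (A B : Z).
Hypotheses (hA : (0 < A)%Z) (hB : B <> 0%Z) (hD : (0 < A ^ 2 - 4 * B)%Z).

Let D := sqrt (IZR (A ^ 2 - 4 * B)).
Let alpha := (IZR A + D) / 2.
Let beta := (IZR A - D) / 2.
Let q := beta / alpha.

Lemma discr_root_sqr : D * D = IZR A * IZR A - 4 * IZR B.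
Proof.
  unfold D. rewrite sqrt_sqrt by (apply IZR_le; lia).
  rewrite minus_IZR, mult_IZR, Z.pow_2_r, mult_IZR. ring.
Qed.

Lemma discr_root_ge_1 : 1 <= D.
Proof. unfold D. rewrite <- sqrt_1. apply sqrt_le_1_alt, IZR_le. lia. Qed.

Lemma root_pos : 0 < alpha.
Proof.
  pose proof discr_root_ge_1. assert (0 < IZR A) by now apply IZR_lt.
  unfold alpha. lra.
Qed.

(** If [beta = 0] then [A = D], which forces [B = 0]; and [|A - D| < A + D] because [A] and [D] are
    positive. *)
Lemma root_quotient_abs : 0 < Rabs q < 1.
Proof.
  pose proof discr_root_ge_1 as h1. pose proof root_pos as h2.
  assert (h3 : 0 < IZR A) by now apply IZR_lt.
  pose proof discr_root_sqr as h4.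
  assert (h5 : IZR B <> 0) by now apply eq_IZR_contrapositive.
  assert (hb : beta <> 0).
  { intros e. unfold beta in e. assert (e' : IZR A = D) by lra.
    rewrite e' in h4. lra. }
  split.
  - apply Rabs_pos_lt. unfold q, Rdiv.
    apply Rmult_integral_contrapositive_currified; [exact hb|].
    apply Rinv_neq_0_compat; lra.
  - unfold q. apply Rabs_def1;
      (apply Rmult_lt_reg_r with alpha; [exact h2|];
       unfold Rdiv; rewrite Rmult_assoc, Rinv_l by lra; unfold beta, alpha; lra).
Qed.

Lemma lucas_binet (n : nat) : D * IZR (lucas A B n) = alpha ^ n - beta ^ n.
Proof.
  pose proof discr_root_sqr as h.
  assert (hb : IZR B = alpha * beta) by (unfold alpha, beta; lra).
  assert (ha : IZR A = alpha + beta) by (unfold alpha, beta; lra).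
  enough (H : D * IZR (lucas A B n) = alpha ^ n - beta ^ n /\
    D * IZR (lucas A B (S n)) = alpha ^ S n - beta ^ S n) by apply H.
  induction n as [|n [IH1 IH2]].
  - simpl. split; [ring|]. unfold alpha, beta. field.
  - split; [exact IH2|].
    change (lucas A B (S (S n))) with (A * lucas A B (S n) - B * lucas A B n)%Z.
    rewrite minus_IZR, !mult_IZR, ha, hb.
    replace (D * _) with ((alpha + beta) * (D * IZR (lucas A B (S n)))
      - alpha * beta * (D * IZR (lucas A B n))) by ring.
    rewrite IH1, IH2. simpl. ring.
Qed.

Lemma root_quotient_pow (n : nat) : (1 <= n)%nat -> Rabs (q ^ n) <= Rabs q < 1.
Proof.
  intros hn. pose proof root_quotient_abs. split; [|lra].
  rewrite <- RPow_abs. destruct n as [|n]; [lia|]. simpl.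
  assert (h : Rabs q ^ n <= 1 ^ n) by (apply pow_incr; lra).
  rewrite pow1 in h. nra.
Qed.

Lemma ln_lucas (n : nat) : (1 <= n)%nat ->
  ln (IZR (lucas A B n)) = INR n * ln alpha - ln D + ln (1 - q ^ n).
Proof.
  intros hn. pose proof discr_root_ge_1 as h1. pose proof root_pos as h2.
  pose proof (root_quotient_pow n hn) as h3. pose proof (Rle_abs (q ^ n)) as h4.
  assert (hp : 0 < alpha ^ n) by now apply pow_lt.
  replace (IZR (lucas A B n)) with (alpha ^ n * / D * (1 - q ^ n)).
  - rewrite !ln_mult, ln_Rinv, ln_pow; try lra.
    + apply Rinv_0_lt_compat; lra.
    + apply Rmult_lt_0_compat; [lra|apply Rinv_0_lt_compat; lra].
  - apply Rmult_eq_reg_l with D; [|lra]. rewrite lucas_binet.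
    unfold q, Rdiv. rewrite Rpow_mult_distr, pow_inv. field. lra.
Qed.

(** The operator kills the term linear in [n], and its coefficients sum to 2, so the constant
    [- ln D] contributes [- 2 * ln D]. *)
Lemma second_diff_ln_lucas (n : nat) : (1 <= n)%nat ->
  second_diff (fun k => ln (IZR (lucas A B k))) n
  = second_diff (fun k => ln (1 - q ^ k)) n - 2 * ln D.
Proof.
  intros hn. unfold second_diff. rewrite !ln_lucas by lia. rewrite !S_INR. ring.
Qed.

(** * Sign of the second difference *)

Lemma Rabs_ln_1_minus_pow_le (m n : nat) : (1 <= n <= m)%nat ->
  Rabs (ln (1 - q ^ m)) <= Rabs q ^ n / (1 - Rabs q).
Proof.
  intros h. pose proof root_quotient_abs as hq.
  destruct (root_quotient_pow m ltac:(lia)) as [h1 h2].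
  eapply Rle_trans; [apply Rabs_ln_1_minus_le; [exact h1|lra]|].
  apply Rmult_le_compat_r; [left; apply Rinv_0_lt_compat; lra|].
  rewrite <- RPow_abs. replace m with (n + (m - n))%nat by lia.
  rewrite pow_add.
  assert (h3 : 0 <= Rabs q ^ n) by (apply pow_le; lra).
  assert (h4 : Rabs q ^ (m - n) <= 1 ^ (m - n)) by (apply pow_incr; lra).
  rewrite pow1 in h4. nra.
Qed.

(** All three logarithms obey the same bound in [|q| ^ n], and the absolute values of the
    coefficients sum to [4 n^2 + 8 n + 2 <= 4 (n + 1)^2]. *)
Lemma second_diff_perturbation_le (n : nat) : (1 <= n)%nat ->
  second_diff (fun k => ln (1 - q ^ k)) n
  <= 4 / (1 - Rabs q) * (INR (S n) ^ 2 * Rabs q ^ n).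
Proof.
  intros hn. pose proof root_quotient_abs as hq.
  pose proof (Rabs_ln_1_minus_pow_le n n ltac:(lia)) as h0.
  pose proof (Rabs_ln_1_minus_pow_le (S n) n ltac:(lia)) as h1.
  pose proof (Rabs_ln_1_minus_pow_le (S (S n)) n ltac:(lia)) as h2.
  unfold second_diff. rewrite S_INR.
  assert (hp : 0 < INR n) by (apply lt_0_INR; lia).
  set (x := INR n) in *.
  replace (4 / (1 - Rabs q) * ((x + 1) ^ 2 * Rabs q ^ n))
    with (4 * (x + 1) ^ 2 * (Rabs q ^ n / (1 - Rabs q))) by (field; lra).
  set (e := Rabs q ^ n / (1 - Rabs q)) in *.
  apply Rabs_le_between in h0, h1, h2.
  assert (k0 : (x + 1) * (x + 2) * ln (1 - q ^ n) <= (x + 1) * (x + 2) * e)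
    by (apply Rmult_le_compat_l; nra).
  assert (k1 : 2 * x * (x + 2) * - ln (1 - q ^ S n) <= 2 * x * (x + 2) * e)
    by (apply Rmult_le_compat_l; nra).
  assert (k2 : x * (x + 1) * ln (1 - q ^ S (S n)) <= x * (x + 1) * e)
    by (apply Rmult_le_compat_l; nra).
  nra.
Qed.

Lemma second_diff_eventually_neg : 1 < D ->
  exists N, forall n, (N <= n)%nat ->
    second_diff (fun k => ln (1 - q ^ k)) n < 2 * ln D.
Proof.
  intros h. pose proof root_quotient_abs as hq.
  assert (hl : 0 < ln D) by (rewrite <- ln_1; apply ln_increasing; lra).
  pose proof (is_lim_seq_scal_l _ (4 / (1 - Rabs q)) _ (lim_sqr_mult_pow _ hq)) as hlim.
  simpl Rbar_mult in hlim. rewrite Rmult_0_r in hlim.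
  apply is_lim_seq_spec in hlim.
  (* The tolerance is [ln D], positive since [D > 1]; taking [S N] also ensures [n >= 1]. *)
  destruct (hlim (mkposreal _ hl)) as [N hN]. exists (S N). intros n hn.
  specialize (hN n ltac:(lia)). simpl pos in hN. rewrite Rminus_0_r in hN.
  apply Rabs_def2 in hN.
  pose proof (second_diff_perturbation_le n ltac:(lia)). lra.
Qed.

Lemma second_diff_neg_of_root_quotient_pos (n : nat) : (1 <= n)%nat -> 0 < q ->
  second_diff (fun k => ln (1 - q ^ k)) n < 0.
Proof.
  intros hn h. unfold second_diff.
  pose proof root_quotient_abs as hq. rewrite Rabs_pos_eq in hq by lra.
  assert (hp : 0 < q ^ n) by now apply pow_lt.
  pose proof (root_quotient_pow n hn) as h1. pose proof (Rle_abs (q ^ n)) as h2.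
  rewrite Rabs_pos_eq in h1 by lra. rewrite (Rabs_pos_eq q) in h1 by lra.
  assert (hx : 0 < INR n) by (apply lt_0_INR; lia).
  set (x := INR n) in *. simpl pow. set (t := q ^ n) in *.
  assert (hqt : 0 < q * t < q) by nra.
  assert (hqqt : 0 < q * (q * t) < q * t) by nra.
  assert (hmono : ln (1 - q * t) < ln (1 - q * (q * t)))
    by (apply ln_increasing; lra).
  assert (hneg : ln (1 - q * (q * t)) < 0)
    by (rewrite <- ln_1; apply ln_increasing; lra).
  (* Strict concavity along the powers of [q]: [(1 - q t)^2 - (1 - t) (1 - q^2 t) = t (1 - q)^2 >
     0]. *)
  assert (hconc : ln (1 - t) + ln (1 - q * (q * t)) < 2 * ln (1 - q * t)).
  { replace (2 * ln (1 - q * t)) with (ln (1 - q * t) + ln (1 - q * t)) by ring.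
    rewrite <- !ln_mult by lra. apply ln_increasing; [apply Rmult_lt_0_compat; lra|].
    apply Rminus_lt.
    replace (_ - _) with (- (t * ((1 - q) * (1 - q)))) by ring.
    assert (0 < t * ((1 - q) * (1 - q))) by (repeat apply Rmult_lt_0_compat; lra).
    lra. }
  set (a := ln (1 - t)) in *. set (b := ln (1 - q * t)) in *.
  set (c := ln (1 - q * (q * t))) in *.
  (* The goal is this product plus [2 (x + 1) (b - c) + 2 b], which is negative because
     [b < c < 0]. *)
  assert (k : (x + 1) * (x + 2) * (a + c - 2 * b) < 0).
  { assert (0 < (x + 1) * (x + 2) * (2 * b - a - c))
      by (repeat apply Rmult_lt_0_compat; lra). lra. }
  nra.
Qed.

Lemma lucas_root_ratio_decreasing :
  exists N, (0 < N)%nat /\ strictly_decreasing_from N (root_ratio (lucas A B)).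
Proof.
  pose proof discr_root_ge_1 as h1. destruct (Rle_lt_or_eq_dec _ _ h1) as [h|h].
  - destruct (second_diff_eventually_neg h) as [N hN].
    exists (S N). split; [lia|]. intros n hn. apply root_ratio_lt; [lia|].
    rewrite second_diff_ln_lucas by lia. specialize (hN n ltac:(lia)). lra.
  - exists 1%nat. split; [lia|]. intros n hn. apply root_ratio_lt; [lia|].
    rewrite second_diff_ln_lucas by lia. rewrite <- h, ln_1.
    enough (hq : 0 < q)
      by (pose proof (second_diff_neg_of_root_quotient_pos n hn hq); lra).
    pose proof root_pos as hp.
    pose proof discr_root_sqr as hs. rewrite <- h in hs.
    assert (hA1 : 1 <= IZR A) by (apply IZR_le; lia).
    assert (hB1 : IZR B <> 0) by now apply eq_IZR_contrapositive.
    (* With [D = 1], the value [A = 1] would give [B = 0]. Hence [A > 1 = D], so [beta > 0]. *)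
    assert (hA2 : IZR A <> 1) by (intros e; rewrite e in hs; lra).
    apply Rdiv_lt_0_compat; [|exact hp].
    unfold beta. rewrite <- h. lra.
Qed.

(** * Convergence of the root ratios to 1 *)

Lemma lim_ln_lucas_div : is_lim_seq (fun n => ln (IZR (lucas A B n)) / INR n) (ln alpha).
Proof.
  pose proof root_quotient_abs as hq.
  (* [M] bounds [|ln (1 - q ^ n) - ln D|] for all [n >= 1], so the sequence is squeezed between
     [ln alpha - M / n] and [ln alpha + M / n]. *)
  set (M := Rabs (ln D) + Rabs q ^ 1 / (1 - Rabs q)).
  assert (hi : is_lim_seq (fun n => / INR n) 0).
  { replace (Finite 0) with (Rbar_inv p_infty) by reflexivity.
    apply is_lim_seq_inv; [apply is_lim_seq_INR | discriminate]. }
  assert (hc : forall c, is_lim_seq (fun n => ln alpha + c * / INR n) (ln alpha)).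
  { intros c. replace (Finite (ln alpha)) with (Finite (ln alpha + c * 0))
      by (f_equal; ring).
    apply is_lim_seq_plus'; [apply is_lim_seq_const|].
    apply is_lim_seq_mult'; [apply is_lim_seq_const|exact hi]. }
  refine (is_lim_seq_le_le_loc _ _ _ _ _ (hc (- M)) (hc M)).
  exists 1%nat. intros n hn. rewrite ln_lucas by exact hn.
  assert (hp : 0 < INR n) by (apply lt_0_INR; lia).
  replace ((INR n * ln alpha - ln D + ln (1 - q ^ n)) / INR n)
    with (ln alpha + (ln (1 - q ^ n) - ln D) * / INR n) by (field; lra).
  assert (hip : 0 < / INR n) by now apply Rinv_0_lt_compat.
  pose proof (Rabs_ln_1_minus_pow_le n 1 ltac:(lia)) as h.
  assert (hb : - M <= ln (1 - q ^ n) - ln D <= M).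
  { apply Rabs_le_between. eapply Rle_trans; [apply Rabs_triang|].
    rewrite Rabs_Ropp. unfold M. lra. }
  split; apply Rplus_le_compat_l, Rmult_le_compat_r; lra.
Qed.

(** The logarithm of the ratio is the difference of consecutive terms of a convergent sequence;
    continuity of [exp] at 0 concludes. *)
Lemma lucas_root_ratio_lim : is_lim_seq (root_ratio (lucas A B)) 1.
Proof.
  pose proof lim_ln_lucas_div as h.
  pose proof h as h'. apply is_lim_seq_incr_1 in h'.
  pose proof (is_lim_seq_minus' _ _ _ _ h' h) as hd.
  rewrite Rminus_diag in hd. rewrite <- exp_0.
  eapply is_lim_seq_ext;
    [|exact (is_lim_seq_continuous exp _ _ (derivable_continuous_pt _ _ (derivable_pt_exp 0)) hd)].
  intros n. symmetry. apply root_ratio_exp.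
Qed.

End Binet.

(** * The Fibonacci case with explicit constants *)

Lemma lucas_fib (n : nat) : lucas 1 (-1) n = fib n.
Proof.
  enough (H : lucas 1 (-1) n = fib n /\ lucas 1 (-1) (S n) = fib (S n)) by apply H.
  induction n as [|n [IH1 IH2]]; [now split|]. split; [exact IH2|].
  change (1 * lucas 1 (-1) (S n) - -1 * lucas 1 (-1) n = fib (S n) + fib n)%Z.
  rewrite IH1, IH2. lia.
Qed.

(** From [n = 6] on, [(n + 1)^2 * 0.382^n] decreases, since [(8/7)^2 * 0.382 < 1]; the bound is its
    value at 6. The constant 0.382 lies just above [(3 - sqrt 5) / 2], the Fibonacci value of
    [|q|]. *)
Lemma sqr_mult_pow_le (r : R) (n : nat) : 0 <= r <= 0.382 -> (6 <= n)%nat ->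
  INR (S n) ^ 2 * r ^ n <= 49 * 0.382 ^ 6.
Proof.
  intros hr hn. apply Rle_trans with (INR (S n) ^ 2 * 0.382 ^ n).
  { apply Rmult_le_compat_l; [apply pow2_ge_0|now apply pow_incr]. }
  induction hn as [|n hn IH]; [simpl; lra|].
  eapply Rle_trans; [|exact IH].
  rewrite (S_INR (S n)).
  assert (h6 : 7 <= INR (S n)) by (replace 7 with (INR 7) by (simpl; lra); apply le_INR; lia).
  assert (hp : 0 < 0.382 ^ n) by (apply pow_lt; lra).
  rewrite <- (tech_pow_Rmult 0.382 n).
  set (x := INR (S n)) in *. set (p := 0.382 ^ n) in *.
  replace ((x + 1) ^ 2 * (0.382 * p)) with (((x + 1) ^ 2 * 0.382) * p) by ring.
  apply Rmult_le_compat_r; nra.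
Qed.

(** The perturbation bound is sharp enough only from [n = 6]; the indices 4 and 5 are checked
    numerically. *)
Lemma fib_root_ratio_decreasing : strictly_decreasing_from 4 (root_ratio (lucas 1 (-1))).
Proof.
  intros n hn. apply root_ratio_lt; [lia|].
  destruct (Nat.eq_dec n 4) as [->|h4]; [|destruct (Nat.eq_dec n 5) as [->|h5]].
  - unfold second_diff. cbn [lucas]. simpl INR.
    simpl Z.mul. simpl Z.sub.
    (* Half the second difference is [15 ln 3 - 24 ln 5 + 10 ln 8], so its sign is an integer
       inequality; the case [n = 5] is analogous. *)
    assert (h : ln (3 ^ 15 * 8 ^ 10) < ln (5 ^ 24)) by (apply ln_increasing; lra).
    rewrite ln_mult, !ln_pow in h by lra. simpl INR in h. lra.
  - unfold second_diff. cbn [lucas]. simpl INR.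
    simpl Z.mul. simpl Z.sub.
    assert (h : ln (5 ^ 21 * 13 ^ 15) < ln (8 ^ 35)) by (apply ln_increasing; lra).
    rewrite ln_mult, !ln_pow in h by lra. simpl INR in h. lra.
  - rewrite second_diff_ln_lucas by lia.
    pose proof (second_diff_perturbation_le 1 (-1) ltac:(lia) ltac:(lia) ltac:(lia) n ltac:(lia)) as h.
    change (1 ^ 2 - 4 * -1)%Z with 5%Z in *.
    set (q := (1 - sqrt 5) / 2 / ((1 + sqrt 5) / 2)) in *.
    assert (hs : sqrt 5 * sqrt 5 = 5) by (apply sqrt_sqrt; lra).
    assert (hs0 : 0 <= sqrt 5) by apply sqrt_pos.
    (* The lower bound yields [|q| < 0.382], hence [1 - |q| > 0.618]. *)
    assert (hsl : 2.236 < sqrt 5) by nra. assert (hsu : sqrt 5 < 2.237) by nra.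
    assert (hq : Rabs q = (3 - sqrt 5) / 2).
    { replace q with (- ((3 - sqrt 5) / 2)).
      - rewrite Rabs_Ropp. apply Rabs_pos_eq. lra.
      - unfold q. apply Rmult_eq_reg_r with (1 + sqrt 5); [|lra].
        field_simplify; [|lra]. nra. }
    (* Here [D = sqrt 5], and [2 * ln D = ln 5 > 1] because [e <= 3]. *)
    assert (hl : 1 < 2 * ln (sqrt 5)).
    { replace (2 * ln (sqrt 5)) with (ln (sqrt 5) + ln (sqrt 5)) by ring.
      rewrite <- ln_mult, hs by lra. rewrite <- (ln_exp 1).
      apply ln_increasing; [apply exp_pos|]. pose proof exp_le_3. lra. }
    pose proof (sqr_mult_pow_le (Rabs q) n ltac:(lra) ltac:(lia)) as hb.
    assert (hk : 4 / (1 - Rabs q) <= 4 / 0.618).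
    { apply Rmult_le_compat_l; [lra|]. apply Rinv_le_contravar; lra. }
    assert (h0 : 0 <= INR (S n) ^ 2 * Rabs q ^ n).
    { apply Rmult_le_pos; [apply pow2_ge_0|apply pow_le; lra]. }
    assert (hf : 4 / (1 - Rabs q) * (INR (S n) ^ 2 * Rabs q ^ n)
                 <= 4 / 0.618 * (49 * 0.382 ^ 6)).
    { apply Rmult_le_compat; try assumption.
      apply Rlt_le, Rdiv_lt_0_compat; lra. }
    (* The numerical bound in [hf] is about 0.986, just below 1. *)
    lra.
Qed.

Lemma root_ratio_ext (u v : nat -> Z) (n : nat) :
  (forall k, u k = v k) -> root_ratio u n = root_ratio v n.
Proof. intros h. unfold root_ratio. now rewrite !h. Qed.

Theorem theorem1p1 :
  (forall A B : Z,
     (0 < A)%Z -> B <> 0%Z -> (0 < A ^ 2 - 4 * B)%Z ->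
     exists N : nat,
       (0 < N)%nat /\
       strictly_decreasing_from N (root_ratio (lucas A B)) /\
       is_lim_seq (root_ratio (lucas A B)) (Finite 1%R)) /\
  ((forall n : nat, lucas 1 (-1) n = fib n) /\
   strictly_decreasing_from 4 (root_ratio fib) /\
   is_lim_seq (root_ratio fib) (Finite 1%R)).
Proof.
  split; [|split; [exact lucas_fib|split]].
  - intros A B hA hB hD.
    destruct (lucas_root_ratio_decreasing A B hA hB hD) as [N [hN hdec]].
    exists N. split; [exact hN|split; [exact hdec|]].
    now apply lucas_root_ratio_lim.
  - intros n hn. rewrite <- !(root_ratio_ext _ _ _ lucas_fib).
    now apply fib_root_ratio_decreasing.
  - apply is_lim_seq_ext with (root_ratio (lucas 1 (-1))).
    + intros n. apply root_ratio_ext, lucas_fib.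
    + apply lucas_root_ratio_lim; lia.
Qed.
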